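(* Let $G$ be a non abelian group of (invertible) affine maps of $\mathbb{R}$. (i) If $G\setminus\mathcal{S}_{1}\neq\emptyset$, then every orbit of $G$ is dense in $\mathbb{R}$. (ii) If $G\subset\mathcal{S}_{1}$, then either all orbits of $G$ are dense in $\mathbb{R}$, or all orbits of $G$ are closed and discrete.
   Context: An (invertible) affine map of $\mathbb{R}$ is a map $x\mapsto\lambda x+c$ with $\lambda\in\mathbb{R}\setminus\{0\}$, $c\in\mathbb{R}$; groups are taken under composition. $\mathcal{S}_1$ is the group of maps $x\mapsto\varepsilon x+c$ with $\varepsilon\in\{-1,1\}$, $c\in\mathbb{R}$. For $v\in\mathbb{R}$, $G(v)=\{f(v):f\in G\}$ is the orbit of $v$. *)

(* Defs.v *)
From mathcomp Require Import all_boot all_order all_algebra.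
From mathcomp Require Import all_classical all_reals all_analysis.

Set Implicit Arguments.
Unset Strict Implicit.
Unset Printing Implicit Defensive.

Import Order.TTheory GRing.Theory Num.Theory.
Import numFieldNormedType.Exports.

Local Open Scope classical_set_scope.
Local Open Scope ring_scope.

Definition affine_maps (R : realType) : set (R -> R) :=
  [set f | exists lambda c : R, lambda != 0 /\ f = (fun x => lambda * x + c)].

Definition S1 (R : realType) : set (R -> R) :=
  [set f | exists eps c : R,
     (eps = -1 \/ eps = 1) /\ f = (fun x => eps * x + c)].

Arguments affine_maps R : clear implicits.
Arguments S1 R : clear implicits.

(* The identity and inverses are those of the group of all bijections of R:
   the neutral element of a group of bijections under composition is
   necessarily the identity map. *)
Definition affine_group (R : realType) (G : set (R -> R)) : Prop :=
  [/\ G `<=` affine_maps R,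
      G idfun,
      forall f g, G f -> G g -> G (f \o g) &
      forall f, G f -> exists g, [/\ G g, g \o f = idfun & f \o g = idfun]].

Definition abelian_maps (R : realType) (G : set (R -> R)) : Prop :=
  forall f g, G f -> G g -> f \o g = g \o f.

Definition orbit_of (R : realType) (G : set (R -> R)) (v : R) : set R :=
  [set f v | f in G].

(* [isolated A] is the set of points of A having a neighborhood that meets A
   only at that point; A is discrete for the induced topology when this set is
   all of A. *)
Definition discrete_subset (T : topologicalType) (A : set T) : Prop :=
  A `<=` isolated A.

(* Main.v *)
Require Import Defs.
From mathcomp Require Import all_boot all_order all_algebra.
From mathcomp Require Import all_classical all_reals all_analysis.
From mathcomp Require Import ring lra.

Set Implicit Arguments.
Unset Strict Implicit.
Unset Printing Implicit Defensive.

Import Order.TTheory GRing.Theory Num.Theory.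
Import numFieldNormedType.Exports.

Local Open Scope classical_set_scope.
Local Open Scope ring_scope.

(** Everything is governed by the additive group of translation lengths,
    [translations G]. Two elements of G with the same slope differ by a
    translation ([same_slope_translation]).

    If G is not abelian, it contains a nontrivial translation: for two maps f
    and g that do not commute, f \o g and g \o f have the same slope. If
    moreover some h in G has slope of absolute value different from 1, then h
    or its inverse is a contraction, and conjugating the translation by powers
    of this contraction gives nonzero translations of arbitrarily small length
    ([contraction_small_translations]). The multiples of a small length form a
    fine grid, so every orbit is dense ([small_translations_dense]).

    If all slopes are 1 or -1, either there are again arbitrarily small nonzero
    translations and every orbit is dense, or the nonzero translation lengths
    are bounded away from 0 by some e. In the latter case an orbit is the union
    of two sets, the images under the elements of slope 1 and those of slope -1.
    Distinct points in one of these sets differ by a translation length, hence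
    lie at distance at least e. Such a set has no limit point
    ([separated_no_limit_point]), so neither has the union, and a set without
    limit points is closed and discrete. *)

(** * Sets without limit points *)

Lemma no_limit_point_closed_discrete (T : topologicalType) (A : set T) :
  limit_point A = set0 -> closed A /\ discrete_subset A.
Proof.
move=> A0; have := closure_isolated_limit_point A; rewrite A0 setU0 => clA.
split; last by rewrite /discrete_subset -clA; exact: subset_closure.
by apply/closure_id/seteqP; split; [exact: subset_closure
                                   |rewrite clA; exact: isolatedS].
Qed.

Lemma no_limit_pointU (T : topologicalType) (A B : set T) :
  limit_point A = set0 -> limit_point B = set0 ->
  limit_point (A `|` B) = set0.
Proof.
move=> A0 B0; rewrite -subset0 => p; suff: ~ limit_point (A `|` B) p by [].
have : ~ limit_point A p by rewrite A0.
have : ~ limit_point B p by rewrite B0.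
rewrite !not_limit_pointE => -[V pV BV] [U pU AU].
by exists (U `&` V); [exact: filterI | move=> x [[Ax|Bx] [Ux Vx]];
  [exact: AU | exact: BV]].
Qed.

(** Near a limit point p there are a point y of A distinct from p and a second
    one closer to p than y, hence two distinct points of A within e. *)
Lemma separated_no_limit_point (R : realType) (A : set R) (e : R) :
  0 < e -> (forall x y, A x -> A y -> `|x - y| < e -> x = y) ->
  limit_point A = set0.
Proof.
move=> e0 sepA; rewrite -subset0 => p limp.
have near_pt r : 0 < r -> exists y, [/\ y != p, A y & `|p - y| < r].
  move=> r0; have [y [yp Ay ry]] := limp _ (nbhsx_ballx p r r0).
  by exists y.
have [y [yp Ay ye]] := near_pt (e / 2) ltac:(lra).
have [|z [_ Az]] := near_pt (Num.min (e / 2) `|p - y|).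
  by rewrite lt_min normr_gt0 subr_eq0 eq_sym yp andbT; lra.
rewrite lt_min => /andP[ze zy].
suff yz : y = z by rewrite yz ltxx in zy.
apply: sepA => //; have := ler_distD p y z; rewrite (distrC y p); lra.
Qed.

(** * Translations in a group of affine maps *)

Definition translations (R : realType) (G : set (R -> R)) : set R :=
  [set t | G (fun x => x + t)].

Section Translations.
Variables (R : realType) (G : set (R -> R)).
Hypothesis HG : affine_group G.

Lemma translationsD s t :
  translations G s -> translations G t -> translations G (s + t).
Proof.
have [_ _ comp _] := HG => Gs Gt.
have -> : s + t = t + s by rewrite addrC.
rewrite /translations /=.
suff <- : (fun x => x + s) \o (fun x => x + t) = (fun x => x + (t + s)).
  exact: comp.
by apply/funext => x /=; rewrite addrA.
Qed.

(** Composing the first map with the inverse of the second cancels the slope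
    and leaves the difference of the constant terms. *)
Lemma same_slope_translation (a c d : R) :
  G (fun x => a * x + c) -> G (fun x => a * x + d) -> translations G (c - d).
Proof.
have [_ _ comp inv] := HG => Gf Gg.
have [h [Gh _ gh]] := inv _ Gg.
rewrite /translations /=.
suff <- : (fun x => a * x + c) \o h = (fun x => x + (c - d)) by exact: comp.
apply/funext => x /=.
have /= := congr1 (fun k => k x) gh => {2}<-; ring.
Qed.

Lemma translationsN t : translations G t -> translations G (- t).
Proof.
have [_ id _ _] := HG => Gt.
have -> : - t = 0 - t by rewrite sub0r.
apply: (@same_slope_translation 1).
- by under eq_fun do rewrite mul1r addr0.
- by under eq_fun do rewrite mul1r.
Qed.

Lemma translationsMz t k : translations G t -> translations G (t *~ k).
Proof.
have [_ id _ _] := HG.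
have natM s n : translations G s -> translations G (s *+ n).
  move=> Gs; elim: n => [|n IH].
    by rewrite mulr0n /translations /=; under eq_fun do rewrite addr0.
  by rewrite mulrS; exact: translationsD.
case: k => n Gt; first exact: natM.
by rewrite NegzE mulrNz; apply: translationsN; exact: natM.
Qed.

Definition small_translations :=
  forall e : R, 0 < e -> exists t, [/\ translations G t, t != 0 & `|t| < e].

Lemma small_translations_dense v : small_translations -> dense (orbit_of G v).
Proof.
move=> small U [u Uu]; rewrite openE => /(_ _ Uu)/nbhs_ballP.
move=> [e /= e0 eU].
have [t [Gt t0 te]] : exists t, [/\ translations G t, 0 < t & t < e].
  have [t [Gt t0 te]] := small _ e0; exists `|t|; split=> //.
  - by case: (ger0P t) => _; [|exact: translationsN].
  - by rewrite normr_gt0.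
(* v + t *~ k is the last point not exceeding u of the grid of step t through v *)
pose k := Num.floor ((u - v) / t).
exists (v + t *~ k); split; last first.
  by exists (fun x => x + t *~ k) => //; exact: translationsMz.
apply: eU; rewrite /ball /=.
have /andP[] := floor_itv ((u - v) / t); rewrite -/k intrD.
rewrite ler_pdivlMr// ltr_pdivrMr// mulrDl mul1r -(mulrzl t k) => k1 k2.
rewrite ger0_norm; lra.
Qed.

Lemma nonabelian_translation :
  ~ abelian_maps G -> exists2 t, translations G t & t != 0.
Proof.
have [aff _ comp _] := HG => nab; apply: contrapT => notrans.
apply: nab => f g Gf Gg.
have [a [c [_ ef]]] := aff _ Gf; have [b [d [_ eg]]] := aff _ Gg.
have Efg : f \o g = (fun x => (a * b) * x + (a * d + c)).
  by rewrite ef eg; apply/funext => x /=; ring.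
have Egf : g \o f = (fun x => (a * b) * x + (b * c + d)).
  by rewrite ef eg; apply/funext => x /=; ring.
have Gt : translations G ((a * d + c) - (b * c + d)).
  by apply: (@same_slope_translation (a * b)); rewrite -?Efg -?Egf; exact: comp.
rewrite Efg Egf; suff -> : a * d + c = b * c + d by [].
apply/eqP; rewrite -subr_eq0; apply/negPn/negP => t0.
by apply: notrans; exists ((a * d + c) - (b * c + d)).
Qed.

(** With h x = a * x + c, the maps x |-> h (x + t) and h both have slope a and
    differ by a * t; their quotient is the conjugate by h of the translation
    by t. *)
Lemma conj_translation (a c t : R) :
  G (fun x => a * x + c) -> translations G t -> translations G (a * t).
Proof.
have [_ _ comp _] := HG => Gh Gt.
have -> : a * t = (a * t + c) - c by ring.
apply: (@same_slope_translation a) => //.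
suff <- : (fun x => a * x + c) \o (fun x => x + t)
        = (fun x => a * x + (a * t + c)) by exact: comp.
by apply/funext => x /=; ring.
Qed.

Lemma contraction_small_translations (a c t : R) :
  G (fun x => a * x + c) -> a != 0 -> `|a| < 1 ->
  translations G t -> t != 0 -> small_translations.
Proof.
move=> Gh a0 a1 Gt t0 e e0.
have et0 : 0 < e / `|t| by rewrite divr_gt0// normr_gt0.
have [n _ /(_ n (leqnn n)) /= ane] := cvgr0_norm_lt _ (cvg_expr a1) _ et0.
exists (a ^+ n * t); split.
- elim: n {ane} => [|n IH]; first by rewrite expr0 mul1r.
  by rewrite exprS -mulrA; exact: conj_translation Gh IH.
- by rewrite mulf_neq0// expf_neq0.
- by rewrite normrM -ltr_pdivlMr// normr_gt0.
Qed.

(** The contraction is an element outside S1 or its inverse, according to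
    whether the absolute value of the slope is below or above 1. *)
Lemma contraction_exists : G `\` S1 R !=set0 ->
  exists a c, [/\ G (fun x => a * x + c), a != 0 & `|a| < 1].
Proof.
have [aff _ _ inv] := HG => -[h [Gh nS1]].
have [a [c [a0 eh]]] := aff _ Gh.
have a1 : `|a| != 1.
  apply/negP => /eqP a1; apply: nS1; exists a, c; split=> //.
  by move/eqP: a1; rewrite eqr_norml ler01 andbT => /orP[] /eqP ->; [right|left].
case: (ltgtP `|a| 1) a1 => // [alt1|agt1] _; first by exists a, c; rewrite -eh.
have [g [Gg _ hg]] := inv _ Gh.
exists a^-1, (- (a^-1 * c)); split; last 2 first.
- by rewrite invr_eq0.
- by rewrite normfV invf_lt1// normr_gt0.
suff <- : g = (fun x => a^-1 * x - a^-1 * c) by [].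
apply/funext => x; have /= := congr1 (fun k => k x) hg.
by rewrite eh => {2}<-; field.
Qed.

(** * Orbits of a group of maps of slopes 1 and -1 *)

Definition slope_orbit (a v : R) : set R :=
  [set y | exists2 c, G (fun x => a * x + c) & y = a * v + c].

Lemma slope_orbit_no_limit_point (a v e : R) : 0 < e ->
  (forall t, translations G t -> `|t| < e -> t = 0) ->
  limit_point (slope_orbit a v) = set0.
Proof.
move=> e0 tr0; apply: (separated_no_limit_point e0).
move=> _ _ [c Gc ->] [d Gd ->].
have -> : a * v + c - (a * v + d) = c - d by ring.
move=> /(tr0 _ (same_slope_translation Gc Gd)) /eqP.
by rewrite subr_eq0 => /eqP ->.
Qed.

Lemma orbit_of_S1 v : G `<=` S1 R ->
  orbit_of G v = slope_orbit 1 v `|` slope_orbit (-1) v.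
Proof.
move=> GS; apply/seteqP; split=> [_ [f Gf <-]|y].
  have [a [c [[] ea ef]]] := GS _ Gf; rewrite {}ea in ef; subst f;
  by [right; exists c | left; exists c].
by case=> -[c Gc ->]; [exists (fun x => 1 * x + c)
                       |exists (fun x => -1 * x + c)].
Qed.

End Translations.

Theorem corollary1p8 (R : realType) (G : set (R -> R))
    (HG : affine_group G) (Hnab : ~ abelian_maps G) :
  (G `\` S1 R !=set0 -> forall v : R, dense (orbit_of G v)) /\
  (G `<=` S1 R ->
     (forall v : R, dense (orbit_of G v)) \/
     (forall v : R, closed (orbit_of G v) /\ discrete_subset (orbit_of G v))).
Proof.
split=> [nS1 v|GS].
  have [a [c [Gh a0 a1]]] := contraction_exists HG nS1.
  have [t Gt t0] := nonabelian_translation HG Hnab.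
  apply: small_translations_dense => //.
  exact: contraction_small_translations Gh a0 a1 Gt t0.
have [small|nsmall] := pselect (small_translations G).
  by left=> v; exact: small_translations_dense.
have [e e0 tr0] : exists2 e, 0 < e &
    forall t, translations G t -> `|t| < e -> t = 0.
  apply: contrapT => noe; apply: nsmall => e e0; apply: contrapT => not.
  apply: noe; exists e => // t Gt te; apply/eqP/negPn/negP => t0.
  by apply: not; exists t.
right=> v; apply: no_limit_point_closed_discrete.
by rewrite orbit_of_S1//; apply: no_limit_pointU;
  exact: slope_orbit_no_limit_point tr0.
Qed.
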